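(* Let $\mathbb{H}$ be a Hilbert space and let $E:\mathbb{H}\to[0,\infty)$ be an error functional, with enhanced coercivity constant $C>0$. Then there is a unique minimizer $\mathbf{u}_\infty\in\mathbb{H}$ such that $E(\mathbf{u}_\infty)=0$, and $$\|\mathbf{u}-\mathbf{u}_\infty\|^2\le C\,E(\mathbf{u})\quad\text{for every }\mathbf{u}\in\mathbb{H}.$$
   Context: A non-negative $C^1$-functional $E:\mathbb{H}\to[0,\infty)$ defined over a Hilbert space $\mathbb{H}$ is called an error functional if: (1) (behavior as $E'\to\mathbf{0}$) $\lim_{E'(\mathbf{u})\to\mathbf{0}}E(\mathbf{u})=0$ over bounded subsets of $\mathbb{H}$, i.e. for every bounded sequence $\{\mathbf{u}_j\}\subset\mathbb{H}$ with $E'(\mathbf{u}_j)\to\mathbf{0}$ one has $E(\mathbf{u}_j)\to0$; and (2) (enhanced coercivity) there is a constant $C>0$ such that for every pair $\mathbf{u},\mathbf{v}\in\mathbb{H}$, $$\|\mathbf{u}-\mathbf{v}\|^2\le C\,(E(\mathbf{u})+E(\mathbf{v})).$$ Here $E'(\mathbf{u})$ is the (Fréchet) derivative of $E$ at $\mathbf{u}$. *)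

(* Defs.v *)
From HB Require Import structures.
From mathcomp Require Import all_boot all_order all_algebra.
From mathcomp Require Import all_classical all_reals all_analysis.

Set Implicit Arguments.
Unset Strict Implicit.
Unset Printing Implicit Defensive.

Import Order.TTheory GRing.Theory Num.Theory.
Import numFieldNormedType.Exports.

Local Open Scope classical_set_scope.
Local Open Scope ring_scope.

(* Real Hilbert spaces: the form is symmetric because [{dot H for idfun}] is
   Hermitian for the trivial conjugation. *)
HB.mixin Record CompleteNormedModule_isHilbert (R : realType) H
    of CompleteNormedModule R H := {
  inner : {dot H for (@idfun R)} ;
  innerE : forall u : H, inner u u = `|u| ^+ 2
}.

#[short(type="hilbertType")]
HB.structure Definition Hilbert (R : realType) :=
  { H of CompleteNormedModule_isHilbert R H & CompleteNormedModule R H }.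

Section error_functional.
Context {R : realType} {H : hilbertType R}.

(* [sup] is [0] by convention when the set is unbounded, so this is the norm of
   the dual of [H] only for bounded linear [f]; differentials are of this kind
   by [diff_continuous]. *)
Definition dual_norm (f : H -> R) : R :=
  sup [set `|f v| | v in [set v : H | `|v| <= 1]].

Definition continuously_differentiable (E : H -> R) : Prop :=
  (forall u, differentiable E u) /\
  (forall u, dual_norm ('d E v \- 'd E u) @[v --> u] --> (0 : R)).

Definition vanishes_with_derivative (E : H -> R) : Prop :=
  forall u : nat -> H, bounded_set (range u) ->
    dual_norm ('d E (u j)) @[j --> \oo] --> (0 : R) ->
    E (u j) @[j --> \oo] --> (0 : R).

Definition enhanced_coercivity (E : H -> R) (C : R) : Prop :=
  0 < C /\ forall u v, `|u - v| ^+ 2 <= C * (E u + E v).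

Definition error_functional (E : H -> R) : Prop :=
  [/\ forall u, 0 <= E u,
      continuously_differentiable E,
      vanishes_with_derivative E
    & exists C, enhanced_coercivity E C].

Definition minimizer (E : H -> R) (u : H) : Prop := forall v, E u <= E v.

End error_functional.

(* Main.v *)
Require Import Defs.
From HB Require Import structures.
From mathcomp Require Import all_boot all_order all_algebra.
From mathcomp Require Import all_classical all_reals all_analysis.
From mathcomp Require Import ring lra.
Import Order.TTheory GRing.Theory Num.Theory.
Import numFieldNormedType.Exports.
Local Open Scope classical_set_scope.
Local Open Scope ring_scope.

(** Enhanced coercivity forces any sequence along which [E] tends to [0] to be
Cauchy; by continuity its limit is a zero of [E], and coercivity applied to the
pair formed by [u] and that zero is exactly the quantitative estimate, which
also gives uniqueness.  So everything rests on producing a sequence with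
[E (u_ j) --> 0].

The first axiom of error functionals reduces this to finding a bounded
sequence of almost critical points.  Since [H] may be infinite dimensional and
[E] has no convexity, a minimizing sequence need not be almost critical;
Ekeland's variational principle ([ekeland]) repairs this.  It yields, for every
[eps > 0], a point [x] with [E x <= E 0] that minimizes
[fun w => E w + eps * `|w - x|], and the slope of [E] at such a point is at
most [eps] ([diff_le_almost_minimizer]).  Taking [eps] along [1 / (j + 1)]
gives differentials tending to [0], and the bound [E x <= E 0] together with
coercivity keeps the points in a ball. *)

(** * Ekeland's variational principle *)

Lemma cvgn_almost_constant {R : realType} {V : completeNormedModType R}
    {x : nat -> V} :
  (forall e : R, 0 < e -> exists y, \forall n \near \oo, `|y - x n| < e) ->
  cvgn x.
Proof.
move=> hx; apply: cauchy_cvg; apply: cauchy_exP => e e0.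
have [y hy] := hx e e0; exists y.
by near=> n; rewrite /= -ball_normE /=; near: n.
Unshelve. all: by end_near. Qed.

(** The descent step of Ekeland's argument: among the points of a set, one is
chosen that realizes at least half of the decrease still possible.  Aiming at
half of it avoids having to prescribe a summable sequence of tolerances. *)
Lemma half_descent {R : realType} {T : Type} {f : T -> R} {S : set T} {x : T} :
  has_lbound (range f) -> S x ->
  exists2 y, S y & forall w, S w -> 2 * f y - f x <= f w.
Proof.
move=> [m fm] Sx.
have Slb : has_lbound (f @` S) by exists m => _ [w _ <-]; apply: fm; exists w.
have Sinf : has_inf (f @` S) by split => //; exists (f x), x.
have infx : inf (f @` S) <= f x by apply: ge_inf => //; exists x.
move: infx; rewrite le_eqVlt => /orP[/eqP fxE | ltfx].
  exists x => // w Sw.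
  have : inf (f @` S) <= f w by apply: ge_inf => //; exists w.
  by rewrite fxE; lra.
have d0 : 0 < (f x - inf (f @` S)) / 2 by lra.
have [_ [y Sy <-] fy] := inf_adherent d0 Sinf.
exists y => // w Sw.
have : inf (f @` S) <= f w by apply: ge_inf => //; exists w.
lra.
Qed.

(** The relation [f w + eps * `|w - x| <= f x] between [w] and [x] is transitive,
and the point sought is one for which no [w] satisfies it strictly.  Following
half of the available descent at each step gives a sequence along which [f]
decreases; it is Cauchy because distances are controlled by the decrease of [f].
A point strictly below its limit would have been available at all steps,
contradicting the choice of the descent. *)
Lemma ekeland {R : realType} {V : completeNormedModType R} {f : V -> R}
    {eps : R} (x0 : V) :
  continuous f -> has_lbound (range f) -> 0 < eps ->
  exists2 x, f x <= f x0 & forall w, f x <= f w + eps * `|w - x|.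
Proof.
move=> cf lbf eps0.
pose S x : set V := [set w | f w + eps * `|w - x| <= f x].
have Sxx x : S x x by rewrite /S /= subrr normr0 mulr0 addr0.
have Strans y x w : S x y -> S y w -> S x w.
  rewrite /S /= => xy yw.
  have : eps * `|w - x| <= eps * (`|w - y| + `|y - x|).
    by rewrite ler_pM2l// ler_distD.
  lra.
have /choice[g gP] : forall x, exists y,
    S x y /\ forall w, S x w -> 2 * f y - f x <= f w.
  by move=> x; have [y] := half_descent lbf (Sxx x); exists y.
pose x n := iter n g x0.
have xS n k : S (x n) (x (n + k)%N).
  elim: k => [|k IH]; first by rewrite addn0.
  by apply: Strans IH _; rewrite addnS; exact: (gP _).1.
have fxS n k : f (x (n + k)%N) <= f (x n).
  have := xS n k; rewrite /S /=.
  have : 0 <= eps * `|x (n + k)%N - x n| by rewrite mulr_ge0// ltW.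
  lra.
have fx_mono : {homo (f \o x) : n m / (n <= m)%N >-> m <= n}.
  by move=> n m nm /=; rewrite -(subnKC nm).
have fx_cvg : cvgn (f \o x).
  apply: nonincreasing_is_cvgn => //.
  by have [m fm] := lbf; exists m => _ [n _ <-]; apply: fm; exists (x n).
set L := limn (f \o x).
have Lle n : L <= f (x n) by exact: nonincreasing_cvgn_ge.
have x_cvg : cvgn x.
  apply: cvgn_almost_constant => e e0.
  have [N _ hN] : \forall n \near \oo, f (x n) < L + eps * e.
    by apply: (cvgr_lt L); [exact: fx_cvg | rewrite ltrDl mulr_gt0].
  exists (x N); exists N => // n /= Nn.
  rewrite distrC -(ltr_pM2l eps0).
  have := hN N (leqnn N); have := xS N (n - N)%N; have := Lle n.
  rewrite /S /= subnKC//; lra.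
set y := limn x.
have fxy : f (x n) @[n --> \oo] --> f y by apply: cvg_comp x_cvg (cf y).
have fyE : f y = L by apply/esym/cvg_lim.
have Sy n : S (x n) y.
  have h : f (x m) + eps * `|x m - x n| @[m --> \oo] -->
           f y + eps * `|y - x n|.
    apply: cvgD => //; apply: cvgM; first exact: cvg_cst.
    apply: cvg_norm.
    by apply: cvgB => //; exact: cvg_cst.
  apply: (cvgr_to_le h); exists n => // m /= nm.
  by rewrite -(subnKC nm); exact: xS.
exists y; first by rewrite fyE; exact: (Lle 0%N).
move=> w; rewrite leNgt; apply/negP => wy.
have Sw n : S (x n) w by apply: Strans (Sy n) _; exact: ltW.
have h : 2 * f (x n.+1) - f (x n) @[n --> \oo] --> 2 * f y - f y.
  apply: cvgB => //; apply: cvgM; first exact: cvg_cst.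
  by rewrite -(cvg_shiftS (f \o x)) in fxy.
have : 2 * f y - f y <= f w.
  by apply: (cvgr_to_le h); near=> n; exact: (gP (x n)).2.
have : 0 <= eps * `|w - y| by rewrite mulr_ge0// ltW.
lra.
Unshelve. all: by end_near. Qed.

(** * Almost critical points *)

(** The one-sided difference quotient of [f] in the direction [v] is at least
[- eps * `|v|]; applying this to [v] and [- v] bounds the differential from
both sides. *)
Lemma diff_le_almost_minimizer {R : realType} {V : normedModType R}
    {f : V -> R} {x : V} {eps : R} :
  differentiable f x -> (forall w, f x <= f w + eps * `|w - x|) ->
  forall v, `|'d f x v| <= eps * `|v|.
Proof.
move=> df hx.
have lower v : - (eps * `|v|) <= 'd f x v.
  rewrite -(deriveE v df).
  have /cvg_dnbhs_at_right h := @diff_derivable _ _ _ _ _ v df.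
  apply: (cvgr_to_ge h); near=> t.
  have t0 : 0 < t by near: t; exact: nbhs_right_gt.
  have := hx (t *: v + x); rewrite addrK normrZ gtr0_norm// => ht.
  rewrite /= [leRHS]mulrC ler_pdivlMr//; lra.
move=> v; rewrite ler_norml lower /=.
by have := lower (- v); rewrite linearN normrN lerN2.
Unshelve. all: by end_near. Qed.

Lemma normr_dual_norm_le {R : realType} {H : hilbertType R} {f : H -> R}
    {eps : R} :
  0 <= eps -> (forall v, `|f v| <= eps * `|v|) -> `|dual_norm f| <= eps.
Proof.
move=> eps0 hf; rewrite /dual_norm; set A := (X in sup X).
have A0 : A `|f 0| by exists 0 => //=; rewrite normr0.
have Aub : ubound A eps.
  by move=> _ [v /= v1 <-]; apply: le_trans (hf v) _; rewrite ler_piMr.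
rewrite ger0_norm; first by apply: ge_sup => //; exists `|f 0|.
by apply: le_trans (normr_ge0 (f 0)) _; apply: ub_le_sup => //; exists eps.
Qed.

(** * Error functionals *)

Section error_functional_zero.
Context {R : realType} {H : hilbertType R} {E : H -> R} {C : R}.
Hypotheses (E_ge0 : forall u, 0 <= E u) (hC : enhanced_coercivity E C).

Lemma sublevel_bounded (M : R) : bounded_set [set u | E u <= M].
Proof.
have [C0 coer] := hC.
(* [`|u| <= 1 + `|u| ^+ 2] spares the square root. *)
exists (1 + C * (M + E 0)); split; first exact: num_real.
move=> K MK u /= uM; apply: le_trans (ltW MK).
have := coer u 0; rewrite subr0.
have : C * (E u + E 0) <= C * (M + E 0) by rewrite ler_pM2l// lerD2r.
have := normr_ge0 u; nra.
Qed.

Lemma vanishing_sequence :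
  (forall u, differentiable E u) -> vanishes_with_derivative E ->
  exists u : nat -> H, E (u j) @[j --> \oo] --> (0 : R).
Proof.
move=> dE vE.
have cE : continuous E by move=> u; exact: differentiable_continuous.
have lbE : has_lbound (range E) by exists 0 => _ [u _ <-].
have /choice[u uP] : forall j, exists x, E x <= E 0 /\
    forall w, E x <= E w + j.+1%:R^-1 * `|w - x|.
  move=> j; have j0 : 0 < j.+1%:R^-1 :> R by rewrite invr_gt0.
  by have [x] := ekeland 0 cE lbE j0; exists x.
exists u; apply: vE.
  have [M [Mreal hM]] := sublevel_bounded (E 0).
  exists M; split => // K /hM bK _ [j _ <-].
  by apply: bK; exact: (uP j).1.
apply/norm_cvg0P.
apply: (squeeze_cvgr _ (cvg_cst 0) cvg_harmonic); near=> j.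
rewrite normr_ge0 /=; apply: normr_dual_norm_le; first by rewrite invr_ge0.
exact: diff_le_almost_minimizer (dE _) (uP j).2.
Unshelve. all: by end_near. Qed.

Lemma cvgn_of_vanishing (u : nat -> H) :
  E (u j) @[j --> \oo] --> (0 : R) -> cvgn u.
Proof.
move=> Eu; have [C0 coer] := hC.
apply: cvgn_almost_constant => e e0.
(* Two values of [E] below this threshold add up to less than [e ^+ 2 / C]. *)
have d0 : 0 < e ^+ 2 / (2 * C) by rewrite divr_gt0 ?exprn_gt0 ?mulr_gt0.
have [N _ hN] : \forall j \near \oo, E (u j) < e ^+ 2 / (2 * C).
  exact: cvgr_lt Eu _ d0.
exists (u N), N => // n /= Nn.
rewrite -(ltr_pXn2r (ltn0Sn 1)) ?nnegrE ?(ltW e0)//.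
apply: le_lt_trans (coer _ _) _.
have -> : e ^+ 2 = C * (e ^+ 2 / (2 * C) + e ^+ 2 / (2 * C)).
  by field; rewrite gt_eqF.
by rewrite ltr_pM2l// ltrD// hN/=.
Qed.

End error_functional_zero.

Theorem proposition1p5 (R : realType) (H : hilbertType R) (E : H -> R) (C : R)
    (hE : error_functional E) (hC : enhanced_coercivity E C) :
  exists u_oo : H,
    [/\ unique (minimizer E) u_oo,
        E u_oo = 0
      & forall u : H, `|u - u_oo| ^+ 2 <= C * E u].
Proof.
have [E_ge0 [dE _] vE _] := hE; have [_ coer] := hC.
have [u Eu] := vanishing_sequence E_ge0 hC dE vE.
have u_cvg := cvgn_of_vanishing hC u Eu.
have E0 : E (limn u) = 0.
  have h : E (u j) @[j --> \oo] --> E (limn u).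
    by apply: cvg_comp u_cvg _; exact: differentiable_continuous.
  exact: cvg_unique h Eu.
have est v : `|v - limn u| ^+ 2 <= C * E v.
  by have := coer v (limn u); rewrite E0 addr0.
exists (limn u); split => //; split; first by move=> v; rewrite E0.
move=> v /(_ (limn u)); rewrite E0 => Ev_le0.
have Ev : E v = 0 by apply/eqP; rewrite eq_le Ev_le0 E_ge0.
have := est v; rewrite Ev mulr0 => est0.
apply/esym/eqP; rewrite -subr_eq0 -normr_eq0 -sqrf_eq0.
by rewrite eq_le est0 exprn_even_ge0.
Qed.
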